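(* Let $D$ be an integral domain such that $\mathrm{Spec}(D)$ is countable. Then every radical semistar operation on $D$ is spectral. If moreover $D$ is a Prüfer domain, then $\star=\widehat{\star}$ for every stable semistar operation $\star$ on $D$.
   Context: Let $D$ be an integral domain with quotient field $K$ and let $\mathbf{F}(D)$ be the set of $D$-submodules of $K$. A semistar operation on $D$ is a map $\star:\mathbf{F}(D)\to\mathbf{F}(D)$, $I\mapsto I^\star$, such that for all $I,J\in\mathbf{F}(D)$ and $x\in K$: $I\subseteq I^\star$; if $I\subseteq J$ then $I^\star\subseteq J^\star$; $(I^\star)^\star=I^\star$; $(xI)^\star=x\cdot I^\star$. A semistar operation $\star$ is stable if $(I\cap J)^\star=I^\star\cap J^\star$ for all $I,J\in\mathbf{F}(D)$. It is quasi-radical if, for every ideal $I$ of $D$, $1\notin I^\star$ implies $1\notin\mathrm{rad}(I)^\star$. It is radical if it is quasi-radical and stable. It is spectral if there is $\Delta\subseteq\mathrm{Spec}(D)$ such that $I^\star=\bigcap_{P\in\Delta}ID_P$ for every $I\in\mathbf{F}(D)$. The quasi-spectrum $\mathrm{QSpec}^\star(D)$ is the set of prime ideals $P$ of $D$ with $P=P^\star\cap D$. For $D$ Prüfer, the pseudo-spectrum $\mathrm{PsSpec}^\star(D)$ is the set of prime ideals $Q$ of $D$ such that $1\in Q^\star$ but there is a $Q$-primary ideal $L$ with $L=L^\star\cap D$. The normalized stable version $\widehat{\star}$ of $\star$ is the semistar operation $$\widehat{\star}:I\mapsto\bigcap_{P\in\mathrm{QSpec}^\star(D)}ID_P\cap\bigcap_{Q\in\mathrm{PsSpec}^\star(D)}(ID_Q)^{v_Q},$$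 where $v_Q$ is the $v$-operation on the valuation domain $D_Q$, i.e. $J^{v_Q}=(D_Q:(D_Q:J))$ for each $D_Q$-submodule $J$ of $K$, with $(A:B)=\{x\in K\mid xB\subseteq A\}$. Empty intersections are $K$. *)

(* Defs.v *)
From mathcomp Require Import all_boot all_algebra.
From mathcomp Require Import boolp classical_sets cardinality.

Set Implicit Arguments.
Unset Strict Implicit.
Unset Printing Implicit Defensive.
Import GRing.Theory.
Local Open Scope classical_set_scope.
Local Open Scope ring_scope.

(* Ideals are arbitrary subsets [set D], not decidable predicates, and need not
   be proper (unlike [idealr_closed] of ring_quotient). *)
Definition ideal (D : idomainType) (I : set D) : Prop :=
  [/\ I 0, forall x y, I x -> I y -> I (x + y) & forall a x, I x -> I (a * x)].

Definition prime_ideal (D : idomainType) (P : set D) : Prop :=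
  [/\ ideal P, ~ P 1 & forall x y, P (x * y) -> P x \/ P y].

Definition Spec (D : idomainType) : set (set D) := [set P | prime_ideal P].
Arguments Spec D : clear implicits.

Definition rad (D : idomainType) (I : set D) : set D :=
  [set x | exists n, I (x ^+ n)].

Definition primary_to (D : idomainType) (Q L : set D) : Prop :=
  [/\ ideal L, ~ L 1, forall x y, L (x * y) -> L x \/ rad L y & rad L = Q].

Definition submodule (D : idomainType) (I : set {fraction D}) : Prop :=
  [/\ I 0, forall x y, I x -> I y -> I (x + y)
         & forall (a : D) x, I x -> I (tofrac a * x)].

Definition inK (D : idomainType) (I : set D) : set {fraction D} :=
  [set tofrac x | x in I].

Definition capD (D : idomainType) (I : set {fraction D}) : set D :=
  [set x | I (tofrac x)].

Definition scale_set (D : idomainType) (x : {fraction D}) (I : set {fraction D}) : set {fraction D} :=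
  [set x * y | y in I].

Definition mul_set (D : idomainType) (I J : set {fraction D}) : set {fraction D} :=
  [set x | exists n (a b : 'I_n -> {fraction D}),
     [/\ forall i, I (a i), forall i, J (b i) & x = \sum_(i < n) a i * b i]].

Definition localization (D : idomainType) (P : set D) : set {fraction D} :=
  [set x | exists a s : D, ~ P s /\ x = tofrac a / tofrac s].

Definition colon (D : idomainType) (A B : set {fraction D}) : set {fraction D} :=
  [set x | scale_set x B `<=` A].

Definition v_op (D : idomainType) (Q : set D) (J : set {fraction D}) : set {fraction D} :=
  colon (localization Q) (colon (localization Q) J).

Definition fin_gen (D : idomainType) (I : set D) : Prop :=
  exists n (a : 'I_n -> D),
    I = [set x | exists c : 'I_n -> D, x = \sum_(i < n) c i * a i].

Definition invertible (D : idomainType) (I : set {fraction D}) : Prop :=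
  exists2 J, submodule J & mul_set I J = inK [set: D].

Definition Prufer (D : idomainType) : Prop :=
  forall I : set D, ideal I -> fin_gen I -> I <> [set 0] -> invertible (inK I).

(* An operation on submodules is a function on all subsets of the quotient
   field that maps submodules to submodules; its values at other subsets are
   irrelevant, since every condition below quantifies over submodules only. *)
Definition semistar (D : idomainType) (star : set {fraction D} -> set {fraction D}) : Prop :=
  (forall I, submodule I -> submodule (star I)) /\
  [/\ forall I, submodule I -> I `<=` star I,
      forall I J, submodule I -> submodule J -> I `<=` J -> star I `<=` star J,
      forall I, submodule I -> star (star I) = star I
    & forall x I, submodule I -> star (scale_set x I) = scale_set x (star I)].

Definition stable (D : idomainType) (star : set {fraction D} -> set {fraction D}) : Prop :=
  forall I J, submodule I -> submodule J ->
    star (I `&` J) = star I `&` star J.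

Definition quasi_radical (D : idomainType) (star : set {fraction D} -> set {fraction D}) :
  Prop := forall I : set D, ideal I ->
    ~ star (inK I) 1 -> ~ star (inK (rad I)) 1.

Definition radical (D : idomainType) (star : set {fraction D} -> set {fraction D}) : Prop :=
  quasi_radical star /\ stable star.

Definition spectral (D : idomainType) (star : set {fraction D} -> set {fraction D}) : Prop :=
  exists2 Delta : set (set D), Delta `<=` Spec D
    & forall I, submodule I ->
        star I = \bigcap_(P in Delta) mul_set I (localization P).

Definition QSpec (D : idomainType) (star : set {fraction D} -> set {fraction D}) :
  set (set D) := [set P | prime_ideal P /\ P = capD (star (inK P))].

Definition PsSpec (D : idomainType) (star : set {fraction D} -> set {fraction D}) :
  set (set D) :=
  [set Q | [/\ prime_ideal Q, star (inK Q) 1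
     & exists2 L, primary_to Q L & L = capD (star (inK L))]].

Definition normalized_stable (D : idomainType)
    (star : set {fraction D} -> set {fraction D}) : set {fraction D} -> set {fraction D} :=
  fun I =>
    (\bigcap_(P in QSpec star) mul_set I (localization P)) `&`
    (\bigcap_(Q in PsSpec star) v_op Q (mul_set I (localization Q))).

(* Main.v *)
Require Import Defs.
From mathcomp Require Import all_boot all_algebra generic_quotient.
From mathcomp Require Import boolp classical_sets cardinality.
From mathcomp Require Import ring.

(** For a stable star, the family F of the ideals I with 1 in I^* is a localizing
    system, and x lies in I^* iff the ideal (I :_D x) is in F; so everything is
    about membership in F.  Countability of Spec D enters through a diagonal
    construction: along an enumeration P_0, P_1, ... of the primes, one chooses
    a_n so that J_n = (J : a_0 ... a_n) stays outside F.

    If J is radical, is not in F, and all primes above J are in F, take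
    a_n in P_n whenever P_n contains J; some prime above J avoids all products of
    the a_i, and yet it is one of the P_n.  This settles radical operations.

    In the Pruefer case take a_n so that J_n is not contained in P_n; then the
    union of the J_n is a proper ideal lying in no prime.  If J_(n-1) is contained
    in P_n, let Q' be the radical of J_(n-1) D_(P_n) contracted to D, a prime since
    D_(P_n) is a valuation domain, and take a_n = b c with b in
    L = J_(n-1) D_Q' meet D and c in Q'.  This is possible when Q' and the
    Q'-primary ideal L are in F.  If x is in the normalized closure of I but not
    in I^*, with J = (I :_D x), the only primes Q above J with a Q-primary ideal
    outside F satisfy J D_Q = Q D_Q (otherwise J is contained in q D_Q with q in Q,
    and 1/(x q) shows that x is not in (I D_Q)^v), and there L is still in F
    because it contains Q'. *)

Set Implicit Arguments.
Unset Strict Implicit.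
Unset Printing Implicit Defensive.
Import GRing.Theory.
Local Open Scope classical_set_scope.
Local Open Scope ring_scope.

Local Notation "x %:F" := (tofrac x).

(** * Fractions and prime ideals *)

Lemma fraction_quotient (D : idomainType) (x : {fraction D}) :
  exists n d : D, d != 0 /\ x = n%:F / d%:F.
Proof.
elim/quotW: x => -[[n d] /= d0]; exists n, d; split=> //.
apply: (canRL (mulfK _)); first by rewrite tofrac_eq0.
(* The product is unfolded to representatives, where equality of fractions is cross
   multiplication. *)
rewrite /GRing.mul /= !piE; apply/eqmodP => /=.
rewrite FracField.equivfE /= !(numden_Ratio, mulr1, mulf_neq0, oner_neq0) //.
by rewrite mulrC.
Qed.

Lemma ideal_mulr (D : idomainType) (I : set D) x a : ideal I -> I x -> I (x * a).
Proof. by case=> _ _ IM /(IM a); rewrite mulrC. Qed.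

Lemma prime_mul (D : idomainType) (P : set D) x y :
  prime_ideal P -> ~ P x -> ~ P y -> ~ P (x * y).
Proof. by case=> _ _ PM Px Py /PM[]. Qed.

Lemma prime_exp (D : idomainType) (P : set D) x n :
  prime_ideal P -> P (x ^+ n) -> P x.
Proof.
move=> pP; elim: n => [|n IH]; first by rewrite expr0; case: pP.
by rewrite exprS; case: (pP) => _ _ PM /PM[|/IH].
Qed.

(** Krull's argument: an ideal maximal among those containing [I] and disjoint from the
    multiplicative set [S] is prime. *)
Lemma exists_prime_disjoint (D : idomainType) (I S : set D) :
  ideal I -> S 1 -> (forall x y, S x -> S y -> S (x * y)) ->
  (forall x, I x -> ~ S x) ->
  exists P, [/\ prime_ideal P, I `<=` P & forall x, P x -> ~ S x].
Proof.
move=> idI S1 SM IS.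
(* The condition is put on the union of [I] and [A], not on [A], so that the empty union of the
   empty chain satisfies it. *)
pose good (A : set D) := ideal (I `|` A) /\ forall x, (I `|` A) x -> ~ S x.
have [F Fgood Ftot|A [[idA AS] Amax]] := @Zorn_bigcup D good.
  split; last first.
    move=> x [/IS//|[A FA Ax]].
    by have [_ AS] := Fgood _ FA; apply: AS; right.
  case: (idI) => I0 ID IM.
  split; first by left.
  - move=> x y [Ix|[A FA Ax]] [Iy|[B FB By]].
    + by left; apply: ID.
    + have [[_ BD _] _] := Fgood _ FB.
      have [|Bxy] := BD x y (or_introl Ix) (or_intror By); first by left.
      by right; exists B.
    + have [[_ AD _] _] := Fgood _ FA.
      have [|Axy] := AD x y (or_intror Ax) (or_introl Iy); first by left.
      by right; exists A.
    + have [C FC [Cx Cy]] : exists2 C, F C & C x /\ C y.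
        by case: (Ftot A B FA FB) => sub; [exists B | exists A] => //;
          split=> //; apply: sub.
      have [[_ CD _] _] := Fgood _ FC.
      have [|Cxy] := CD x y (or_intror Cx) (or_intror Cy); first by left.
      by right; exists C.
  - move=> a x [Ix|[A FA Ax]]; first by left; apply: IM.
    have [[_ _ AM] _] := Fgood _ FA.
    have [|Aax] := AM a x (or_intror Ax); first by left.
    by right; exists A.
set P := I `|` A in idA AS.
have Pmax x : ~ P x -> exists m c, P m /\ S (m + c * x).
  move=> Px; apply: contrapT => noS.
  pose B := [set z | exists m c, P m /\ z = m + c * x].
  have PB : P `<=` B by move=> z Pz; exists z, 0; rewrite mul0r addr0.
  case: (idA) => P0 PD PM.
  have Bx : B x by exists 0, 1; rewrite mul1r add0r.
  apply: (Amax B).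
    split; first by move=> z Az; apply: PB; right.
    by move=> /(_ _ Bx) Ax; apply: Px; right.
  have IB : I `|` B = B by apply/setUidPr => z Iz; apply: PB; left.
  rewrite /good IB; split; last first.
    by move=> z [m [c [Pm ->]]] Sz; apply: noS; exists m, c.
  split; first exact: PB.
  - move=> _ _ [m [c [Pm ->]]] [m' [c' [Pm' ->]]].
    by exists (m + m'), (c + c'); split; [exact: PD | ring].
  - move=> a _ [m [c [Pm ->]]].
    by exists (a * m), (a * c); split; [exact: PM | ring].
exists P; split=> //; last by move=> z Iz; left.
split=> //; first by move=> P1; apply: (AS 1).
move=> x y Pxy; apply: contrapT => /not_orP[/Pmax[m [c [Pm Smx]]]].
move=> /Pmax[m' [c' [Pm' Smy]]].
apply: (AS ((m + c * x) * (m' + c' * y))); last exact: SM.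
case: (idA) => _ PD PM.
have -> : (m + c * x) * (m' + c' * y)
        = (m' + c' * y) * m + (c * x) * m' + (c * c') * (x * y) by ring.
by apply: (PD); [apply: PD|]; apply: PM.
Qed.

(** * Ideal quotients and localizing systems *)

Definition quo (D : idomainType) (I : set D) (p : D) : set D :=
  [set t | I (t * p)].

Lemma ideal_quo (D : idomainType) (I : set D) p : ideal I -> ideal (quo I p).
Proof.
case=> I0 ID IM; split=> [|x y|a x]; rewrite /quo /= ?mul0r ?mulrDl //.
- exact: ID.
- by rewrite -mulrA; apply: IM.
Qed.

Lemma quoM (D : idomainType) (I : set D) p a : quo (quo I p) a = quo I (p * a).
Proof. by apply/seteqP; split=> t; rewrite /quo /= -mulrA (mulrC a). Qed.

Lemma quo1 (D : idomainType) (I : set D) : quo I 1 = I.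
Proof. by apply/seteqP; split=> t; rewrite /quo /= mulr1. Qed.

Lemma quo_mem (D : idomainType) (I : set D) p : ideal I -> I p -> quo I p = setT.
Proof. by move=> [_ _ IM] Ip; apply/seteqP; split=> // t _; apply: IM. Qed.

Lemma sub_quo (D : idomainType) (I : set D) p : ideal I -> I `<=` quo I p.
Proof. by move=> idI x Ix; apply: ideal_mulr. Qed.

(** A Gabriel filter; the values of [F] off the ideals are irrelevant. *)
Definition localizing (D : idomainType) (F : set (set D)) : Prop :=
  [/\ F [set: D],
      forall I J, ideal I -> ideal J -> F I -> I `<=` J -> F J
    & forall I J, ideal I -> ideal J -> F J ->
        (forall a, J a -> F (quo I a)) -> F I].

(** The single step of the diagonal construction: if all (I : pa) with a in [A] were in [F], the
    third axiom would put (I : p) in [F]. *)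
Lemma localizing_quo (D : idomainType) (F : set (set D)) (I A : set D) p :
  localizing F -> ideal I -> ideal A -> F A -> ~ F (quo I p) ->
  exists2 a, A a & ~ F (quo I (p * a)).
Proof.
move=> [_ _ Fgab] idI idA FA nF; apply: contrapT => noa; apply: nF.
apply: (Fgab _ A) => // [|a Aa]; first exact: ideal_quo.
by rewrite quoM; apply: contrapT => nF; apply: noa; exists a.
Qed.

(** * The diagonal construction along the primes *)

Lemma countable_avoidance (D : idomainType) (good : set D)
    (met : set D -> set D) :
  countable (Spec D) -> good 1 ->
  (forall Q p, prime_ideal Q -> good p ->
     exists a, good (p * a) /\ met Q (p * a)) ->
  exists u : nat -> D,
    [/\ forall n, good (u n),
        forall m n, (m <= n)%N -> exists c, u n = u m * c
      & forall Q, prime_ideal Q -> exists n, met Q (u n)].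
Proof.
move=> /countable_injP[f finj] good1 step.
(* The next factor depends on the stage and on the product so far; it defaults to 1 when the stage
   codes no prime or the product is not good. *)
have [|g gP] := @choice (nat * D) D (fun np a => good np.2 ->
    good (np.2 * a) /\
    forall Q, prime_ideal Q -> f Q = np.1 -> met Q (np.2 * a)).
  move=> [n p] /=; have [[Q [pQ fQ]]|noQ] :=
    pselect (exists Q, prime_ideal Q /\ f Q = n).
    have [gp|ngp] := pselect (good p); last by exists 1.
    have [a [ga ma]] := step Q p pQ gp; exists a => _; split=> // Q' pQ' fQ'.
    by rewrite (finj Q' Q) ?inE ?fQ.
  exists 1; rewrite mulr1 => gp; split=> // Q pQ fQ.
  by case: noQ; exists Q.
pose u := fix u n := if n is m.+1 then u m * g (m, u m) else 1.
have ug n : good (u n).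
  by elim: n => //= n IH; have [] := gP (n, u n) IH.
exists u; split=> //.
  move=> m n /subnK <-; elim: (n - m)%N => [|k [c IH]].
    by exists 1; rewrite add0n mulr1.
  by exists (c * g ((k + m)%N, u (k + m)%N)); rewrite addSn /= IH mulrA.
move=> Q pQ; exists (f Q).+1 => /=.
by have [_] := gP (f Q, u (f Q)) (ug _); apply.
Qed.

Lemma localizing_radical_prime (D : idomainType) (F : set (set D)) (I : set D) :
  countable (Spec D) -> localizing F -> ideal I -> Defs.rad I = I -> ~ F I ->
  exists P, [/\ prime_ideal P, I `<=` P & ~ F P].
Proof.
move=> cS locF idI radI nFI; apply: contrapT => noP.
have [FT _ _] := locF.
pose good p := ~ F (quo I p).
pose met (Q : set D) p := I `<=` Q -> Q p.
have [|Q p pQ gp|u [ug udiv umet]] := @countable_avoidance D good met cS.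
- by rewrite /good quo1.
- have [IQ|nIQ] := pselect (I `<=` Q); last by exists 1; rewrite mulr1; split.
  have idQ : ideal Q by case: pQ.
  have FQ : F Q by apply: contrapT => nFQ; apply: noP; exists Q.
  have [a Qa na] := localizing_quo locF idI idQ FQ gp.
  by exists a; split=> // _; case: idQ => _ _; apply.
(* Divisors of powers are taken, not just powers: since [u m] divides [u n] for m <= n, this makes
   [S] closed under products. *)
pose S := [set s | exists n k c, s * c = u n ^+ k].
have [||s Is [n [k [c]]]|P [pP IP PS]] := @exists_prime_disjoint D I S idI.
- by exists 0%N, 0%N, 1; rewrite mulr1.
- move=> x y [n [k [c xc]]] [m [l [d yd]]].
  wlog nm : x y n k c xc m l d yd / (n <= m)%N.
    move=> W; have [nm|/ltnW mn] := leqP n m; first exact: (W x y n k c xc m l d).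
    by rewrite mulrC; apply: (W y x m l d yd n k c).
  have [e ue] := udiv _ _ nm.
  exists m, (k + l)%N, (c * d * e ^+ k).
  by rewrite exprD {1}ue exprMn -xc -yd; ring.
- move=> sc; apply: (ug n); rewrite quo_mem // -radI; exists k.
  by rewrite -sc; apply: ideal_mulr.
have [n Pn] := umet P pP.
by apply: (PS (u n) (Pn IP)); exists n, 1%N, 1; rewrite mulr1 expr1.
Qed.

(** * Valuation localizations and primary ideals *)

(** This says that [D_Q] is a valuation domain, with denominators cleared: one of [a], [b] is a
    multiple of the other in [D_Q]. *)
Definition valuation_at (D : idomainType) (Q : set D) : Prop :=
  forall a b : D, exists s c, ~ Q s /\ (s * a = c * b \/ s * b = c * a).

(** [J D_Q] contracted to [D]. *)
Definition sat (D : idomainType) (Q J : set D) : set D :=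
  [set x | exists2 s, ~ Q s & J (s * x)].

Lemma ideal_sat (D : idomainType) (Q J : set D) :
  prime_ideal Q -> ideal J -> ideal (sat Q J).
Proof.
move=> pQ idJ; have [J0 JD JM] := idJ; split.
- by exists 1; [case: pQ | rewrite mulr0].
- move=> x y [s Qs Jsx] [t Qt Jty]; exists (s * t); first exact: prime_mul.
  have -> : s * t * (x + y) = t * (s * x) + s * (t * y) by ring.
  by apply: JD; apply: JM.
- move=> a x [s Qs Jsx]; exists s => //.
  by rewrite mulrCA; apply: JM.
Qed.

Lemma sub_sat (D : idomainType) (Q J : set D) : prime_ideal Q -> J `<=` sat Q J.
Proof. by case=> _ Q1 _ x Jx; exists 1; rewrite ?mul1r. Qed.

(** If x is a multiple of y in [D_Q], then x + y is again a multiple of y, and x^2 is a multiple of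
    xy. The first gives sums, the second primality. *)
Lemma prime_rad_sat (D : idomainType) (Q J : set D) :
  prime_ideal Q -> valuation_at Q -> ideal J -> J `<=` Q ->
  prime_ideal (Defs.rad (sat Q J)).
Proof.
move=> pQ val idJ JQ; have [idQ Q1 QM] := pQ.
have idS := ideal_sat pQ idJ; have [S0 SD SM] := idS.
have satQ s x : ~ Q s -> sat Q J (s * x) -> sat Q J x.
  by move=> Qs [t Qt Jx]; exists (t * s); [exact: prime_mul | rewrite -mulrA].
have sum x y s c : ~ Q s -> s * x = c * y -> Defs.rad (sat Q J) y ->
    Defs.rad (sat Q J) (x + y).
  move=> Qs sx [n Sy]; exists n; apply: (satQ (s ^+ n)).
    by move=> /(prime_exp pQ).
  have -> : s ^+ n * (x + y) ^+ n = (c + s) ^+ n * y ^+ n.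
    by rewrite -!exprMn; congr (_ ^+ n); rewrite mulrDr sx mulrDl.
  exact: SM.
split; first split.
- by exists 1%N; rewrite expr1.
- move=> x y rx ry; have [s [c [Qs [sx|sy]]]] := val x y.
    exact: sum Qs sx ry.
  by rewrite addrC; exact: sum Qs sy rx.
- by move=> a x [n Sx]; exists n; rewrite exprMn; apply: SM.
- by move=> [n]; rewrite expr1n => -[s Qs]; rewrite mulr1 => /JQ.
- move=> x y; wlog [s [c [Qs sx]]] : x y / exists s c, ~ Q s /\ s * x = c * y.
    move=> W; have [s [c [Qs [sx|sy]]]] := val x y => rxy.
      by apply: W => //; exists s, c.
    by apply/or_comm; apply: W; [exists s, c | rewrite mulrC].
  move=> [n Sn]; left; exists (n + n)%N; apply: (satQ (s ^+ n)).
    by move=> /(prime_exp pQ).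
  have -> : s ^+ n * x ^+ (n + n) = c ^+ n * (x * y) ^+ n.
    by rewrite exprD mulrA -exprMn sx !exprMn; ring.
  exact: SM.
Qed.

(** Elements outside [Q] become units in [D_Q], so they can be cancelled from a product in the
    saturation. *)
Lemma primary_sat (D : idomainType) (Q J : set D) :
  prime_ideal Q -> ideal J -> J `<=` Q -> (forall x, Q x -> Defs.rad (sat Q J) x) ->
  primary_to Q (sat Q J).
Proof.
move=> pQ idJ JQ radJ; have [idQ Q1 QM] := pQ.
have satsub : sat Q J `<=` Q by move=> x [s Qs /JQ/QM[]].
have radE : Defs.rad (sat Q J) = Q.
  by apply/seteqP; split=> // x [n /satsub/(prime_exp pQ)].
split=> //; first exact: ideal_sat.
  by move=> /satsub.
move=> x y [s Qs Jsxy]; rewrite radE.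
have [Qy|Qy] := pselect (Q y); [by right | left].
by exists (s * y); [exact: prime_mul | rewrite -mulrA (mulrC y)].
Qed.

Lemma localizing_valuation (D : idomainType) (F : set (set D)) (J : set D) :
  countable (Spec D) -> localizing F ->
  (forall Q : set D, prime_ideal Q -> valuation_at Q) -> ideal J ->
  (forall Q, prime_ideal Q -> J `<=` Q ->
     F Q /\ ((forall L, primary_to Q L -> F L) \/ Q `<=` sat Q J)) ->
  F J.
Proof.
move=> cS locF val idJ hJ; apply: contrapT => nFJ.
have [FT Fsub _] := locF.
pose good p := ~ F (quo J p).
pose met (Q : set D) p := ~ quo J p `<=` Q.
have [|Q p pQ gp|u [ug udiv umet]] := @countable_avoidance D good met cS.
- by rewrite /good quo1.
- have [JQ|nJQ] := pselect (quo J p `<=` Q); last by exists 1; rewrite mulr1; split.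
  have idJp := ideal_quo p idJ.
  pose Q' := Defs.rad (sat Q (quo J p)).
  have pQ' : prime_ideal Q' by apply: prime_rad_sat => //; exact: val.
  have [idQ' Q'1 Q'M] := pQ'.
  have Q'Q : Q' `<=` Q.
    by move=> x [n [s Qs /JQ]]; case: (pQ) => _ _ QM /QM[|/(prime_exp pQ)].
  have JQ' : quo J p `<=` Q'.
    by move=> x Jx; exists 1%N; rewrite expr1; exact: sub_sat.
  have [FQ' alt] := hJ Q' pQ' (subset_trans (sub_quo p idJ) JQ').
  have FL : F (sat Q' (quo J p)).
    have idL := ideal_sat pQ' idJp.
    case: alt => [prim|Q'sub].
      (* [Q'] was formed with denominators outside [Q]; these are also outside the smaller prime
         [Q']. *)
      apply: prim; apply: primary_sat => // x [n [s Qs Jx]].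
      by exists n, s => // /Q'Q.
    apply: (Fsub Q') => // x /Q'sub[s Q's Jsx]; exists s => //.
    exact: sub_quo.
  have [b [s Q's Jsb] nb] := localizing_quo locF idJ (ideal_sat pQ' idJp) FL gp.
  have [c Q'c nc] := localizing_quo locF idJ idQ' FQ' nb.
  exists (b * c); rewrite mulrA; split=> // sub.
  (* c lies in s D_Q because s is outside Q', so s b in J_p gives b c in J_p D_Q *)
  have [t [d [Qt [tc|ts]]]] := val _ pQ c s.
    apply/Qt/sub; rewrite /quo /=.
    have -> : t * (p * b * c) = (t * c) * (p * b) by ring.
    have -> : t * c * (p * b) = d * (s * b * p) by rewrite tc; ring.
    by case: idJ => _ _; apply.
  (* The other alternative is impossible: [d * c] is in the prime [Q'], but neither [t] nor [s]
     is. *)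
  have : Q' (t * s) by rewrite ts; case: idQ' => _ _; apply.
  by case/Q'M => // /Q'Q.
pose U := [set x | exists n, quo J (u n) x].
have idU : ideal U.
  have idq n := ideal_quo (u n) idJ.
  have mono m n x : (m <= n)%N -> quo J (u m) x -> quo J (u n) x.
    by move=> /udiv[c ->]; rewrite -quoM; exact: sub_quo.
  split; first by exists 0%N; case: (idq 0%N).
    move=> x y [m Jx] [n Jy]; exists (maxn m n).
    case: (idq (maxn m n)) => _ add _; apply: add.
      exact: mono (leq_maxl m n) Jx.
    exact: mono (leq_maxr m n) Jy.
  by move=> a x [n Jx]; exists n; case: (idq n) => _ _; apply.
(* Disjointness from 1 is properness: were 1 in some [quo J (u n)], that ideal would be all of [D],
   hence in [F]. *)
have [||x [n Jx] x1|P [pP UP _]] := @exists_prime_disjoint D U [set 1] idU.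
- by [].
- by move=> x y -> ->; rewrite mulr1.
- apply: (ug n); rewrite quo_mem //.
  by move: Jx; rewrite x1 /quo /= mul1r.
have [n] := umet P pP; apply=> x Jx.
by apply: UP; exists n.
Qed.

(** * From stable semistar operations to localizing systems *)

Lemma submodule_inK (D : idomainType) (I : set D) : ideal I -> submodule (inK I).
Proof.
case=> I0 ID IM; split.
- by exists 0; rewrite ?tofrac0.
- by move=> _ _ [x Ix <-] [y Iy <-]; exists (x + y); [exact: ID | rewrite tofracD].
- by move=> a _ [x Ix <-]; exists (a * x); [exact: IM | rewrite tofracM].
Qed.

Lemma submodule_scale (D : idomainType) x (I : set {fraction D}) :
  submodule I -> submodule (scale_set x I).
Proof.
case=> I0 ID IM; split.
- by exists 0; rewrite ?mulr0.
- by move=> _ _ [y Iy <-] [z Iz <-]; exists (y + z); [exact: ID | rewrite mulrDr].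
- by move=> a _ [y Iy <-]; exists (a%:F * y); [exact: IM | rewrite mulrCA].
Qed.

Lemma inKE (D : idomainType) (I : set D) a : inK I a%:F <-> I a.
Proof.
split=> [[b Ib /eqP]|Ia]; last by exists a.
by rewrite tofrac_eq => /eqP <-.
Qed.

Lemma inK_subset (D : idomainType) (I J : set D) : I `<=` J -> inK I `<=` inK J.
Proof. by move=> IJ _ [x /IJ Jx <-]; exists x. Qed.

Lemma ideal_setT (D : idomainType) : ideal [set: D].
Proof. by []. Qed.

(** [(I :_D x)], taken in [D] and not in the quotient field. *)
Definition conductor (D : idomainType) (I : set {fraction D}) x : set D :=
  [set t | I (t%:F * x)].

Lemma ideal_conductor (D : idomainType) (I : set {fraction D}) x :
  submodule I -> ideal (conductor I x).
Proof.
case=> I0 ID IM; split=> [|s t|a s]; rewrite /conductor /=.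
- by rewrite tofrac0 mul0r.
- by rewrite tofracD mulrDl; exact: ID.
- by rewrite tofracM -mulrA; exact: IM.
Qed.

Lemma conductor_inK (D : idomainType) (I : set D) a :
  conductor (inK I) a%:F = quo I a.
Proof.
by apply/seteqP; split=> t; rewrite /conductor /quo /= -tofracM => /inKE.
Qed.

(** For [x <> 0] the conductor of x into I is x^-1 I meet D, and stability lets
   the star pass through this intersection. *)
Lemma stable_memE (D : idomainType) (star : set {fraction D} -> set {fraction D})
    (I : set {fraction D}) x :
  semistar star -> stable star -> submodule I ->
  star I x <-> star (inK (conductor I x)) 1.
Proof.
move=> [subS [ext _ _ scal]] stab subI.
have sT : submodule (inK [set: D]) by apply/submodule_inK/ideal_setT.
have T1 : star (inK [set: D]) 1.
  by apply: ext => //; rewrite -tofrac1; exists 1.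
have [->|x0] := eqVneq x 0.
  have -> : conductor I 0 = setT.
    by apply/seteqP; split=> // t _; rewrite /conductor /= mulr0; case: subI.
  by split=> // _; case: (subS _ subI).
have -> : inK (conductor I x) = scale_set x^-1 I `&` inK [set: D].
  apply/seteqP; split=> [_ [t It <-]|_ [[y Iy <-] [t _ tE]]].
    by split; [exists (t%:F * x) => //; rewrite mulrCA mulVf ?mulr1 | exists t].
  exists t => //; rewrite /conductor /= tE.
  by rewrite mulrAC mulVf ?mul1r.
rewrite stab //; last exact: submodule_scale.
rewrite scal //; split=> [Ix|[[y Iy yx] _]].
  by split=> //; exists x => //; rewrite mulVf.
by have <- : y = x by rewrite -[y](mulVKf x0) yx mulr1.
Qed.

(** The third axiom comes from idempotence: if every (I : a) with a in [J] is in the system, then J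
    lies in I^*, so 1 in J^* gives 1 in I^** = I^*. *)
Lemma stable_localizing (D : idomainType)
    (star : set {fraction D} -> set {fraction D}) :
  semistar star -> stable star -> localizing (fun I => star (inK I) 1).
Proof.
move=> ss stab; have [subS [ext mono idem _]] := ss; split.
- apply: ext; first exact/submodule_inK/ideal_setT.
  by rewrite -tofrac1; exists 1.
- move=> I J idI idJ FI IJ; apply: mono FI; try exact: submodule_inK.
  exact: inK_subset.
- move=> I J idI idJ FJ FQ; have sI := submodule_inK idI.
  rewrite -idem //; apply: mono FJ; first exact: submodule_inK.
    exact: subS.
  move=> _ [a Ja <-]; apply/stable_memE => //.
  by rewrite conductor_inK; exact: FQ.
Qed.

Lemma mul_localizationE (D : idomainType) (P : set D) (I : set {fraction D}) x :
  prime_ideal P -> submodule I ->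
  mul_set I (localization P) x <-> exists2 s, ~ P s & I (s%:F * x).
Proof.
move=> pP [I0 ID IM]; have [[P0 _ _] P1 _] := pP.
have nz s : ~ P s -> s%:F != 0.
  by move=> Ps; rewrite tofrac_eq0; apply/eqP => s0; apply: Ps; rewrite s0.
split=> [[n [a [b [Ia bP ->]]]]|[s Ps Isx]].
  apply: (big_ind (fun x => exists2 s, ~ P s & I (s%:F * x))).
  - by exists 1 => //; rewrite mulr0.
  - move=> y z [s Ps Isy] [t Pt Itz]; exists (s * t); first exact: prime_mul.
    have -> : (s * t)%:F * (y + z) = t%:F * (s%:F * y) + s%:F * (t%:F * z).
      by rewrite tofracM; ring.
    by apply: ID; apply: IM.
  - move=> i _; have [c [s [Ps ->]]] := bP i; exists s => //.
    have -> : s%:F * (a i * (c%:F / s%:F)) = c%:F * a i.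
      by rewrite mulrCA (mulrC s%:F) divfK ?nz // mulrC.
    exact: IM.
exists 1%N, (fun=> s%:F * x), (fun=> 1%:F / s%:F); split=> // [_|].
  by exists 1, s.
by rewrite big_ord1 tofrac1 mul1r mulrC mulKf ?nz.
Qed.

(** * Localizations of Prüfer domains, and primary ideals *)

(** Invertibility of (a, b) gives 1 = au + bv with au, bu, av, bv in [D]. One of p = au and q = bv
    is outside [Q], and p b = (bu) a, q a = (av) b. *)
Lemma Prufer_valuation (D : idomainType) (Q : set D) :
  Prufer D -> prime_ideal Q -> valuation_at Q.
Proof.
move=> prD [[Q0 QD QM] Q1 _] a b.
have [->|a0] := eqVneq a 0.
  by exists 1, 0; split=> //; left; rewrite mulr0 mul0r.
pose I := [set x | exists u v : D, x = u * a + v * b].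
have idI : ideal I.
  split; first by exists 0, 0; ring.
    move=> _ _ [u [v ->]] [u' [v' ->]]; exists (u + u'), (v + v'); ring.
  by move=> c _ [u [v ->]]; exists (c * u), (c * v); ring.
have fgI : fin_gen I.
  exists 2, (fun i => if i == ord0 then a else b); apply/seteqP; split=> x.
    move=> [u [v ->]]; exists (fun i => if i == ord0 then u else v).
    by rewrite big_ord_recl big_ord1.
  by move=> [c ->]; rewrite big_ord_recl big_ord1 /=; eexists; eexists.
have Ia : I a by exists 1, 0; ring.
have Ib : I b by exists 0, 1; ring.
have [|J [J0 JD JM] IJ] := prD I idI fgI.
  by move=> I0; move: Ia; rewrite I0 => /eqP; rewrite (negPf a0).
have integral x y : I x -> J y -> exists t, x%:F * y = t%:F.
  move=> Ix Jy; have : mul_set (inK I) J (x%:F * y).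
    exists 1%N, (fun=> x%:F), (fun=> y); rewrite big_ord1; split=> // _.
    exact/inKE.
  by rewrite IJ => -[t _ <-]; exists t.
have [u [v [Ju Jv uv]]] : exists u v, [/\ J u, J v & 1 = a%:F * u + b%:F * v].
  have [n [x [y [Ix Jy ->]]]] : mul_set (inK I) J 1.
    by rewrite IJ -tofrac1; exists 1.
  apply: (big_ind (fun z => exists u v, [/\ J u, J v & z = a%:F * u + b%:F * v])).
  - by exists 0, 0; split=> //; rewrite !mulr0 addr0.
  - move=> _ _ [u [v [Ju Jv ->]]] [u' [v' [Ju' Jv' ->]]].
    by exists (u + u'), (v + v'); split; [exact: JD|exact: JD|ring].
  - move=> i _; have [_ [c [d ->]] <-] := Ix i.
    exists (c%:F * y i), (d%:F * y i); split; try exact: JM.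
    by rewrite tofracD !tofracM; ring.
have [p pE] := integral a u Ia Ju; have [q qE] := integral b v Ib Jv.
have pq : 1 = p + q.
  by apply/eqP; rewrite -tofrac_eq tofracD tofrac1 -pE -qE uv.
have inj (x y : D) : x%:F = y%:F -> x = y by move/eqP; rewrite tofrac_eq => /eqP.
have [Qp|Qp] := pselect (Q p); last first.
  have [t tE] := integral b u Ib Ju; exists p, t; split=> //; right.
  by apply: inj; rewrite !tofracM -pE -tE; ring.
have Qq : ~ Q q by move=> Qq; apply: Q1; rewrite pq; exact: QD.
have [t tE] := integral a v Ia Jv; exists q, t; split=> //; left.
by apply: inj; rewrite !tofracM -qE -tE; ring.
Qed.

(** Outside a valuation ring an element has its inverse, here [c/s], in the maximal ideal. *)
Lemma notin_localization (D : idomainType) (Q : set D) (z : {fraction D}) :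
  prime_ideal Q -> valuation_at Q -> ~ localization Q z ->
  exists s c, [/\ ~ Q s, Q c & z * c%:F = s%:F].
Proof.
move=> pQ val; have [[Q0 _ _] _ _] := pQ.
have [n [d [d0 ->]]] := fraction_quotient z => Qz.
have dF : d%:F != 0 by rewrite tofrac_eq0.
have [s [c [Qs [sn|sd]]]] := val n d.
  case: Qz; exists c, s; split=> //.
  have sF : s%:F != 0.
    by rewrite tofrac_eq0; apply/eqP => s0; apply: Qs; rewrite s0.
  by apply/eqP; rewrite eqr_div // -!tofracM mulrC sn.
have zc : n%:F / d%:F * c%:F = s%:F.
  rewrite mulrAC; apply: (canLR (mulfK dF)).
  by rewrite -!tofracM sd mulrC.
exists s, c; split=> //; apply: contrapT => Qc; apply: Qz; exists s, c.
have cF : c%:F != 0.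
  by rewrite tofrac_eq0; apply/eqP => c0; apply: Qc; rewrite c0.
by split=> //; rewrite -zc mulfK.
Qed.

(** [c D_Q] contracted to [D] is in [F], hence so is that of [c ^+ n D_Q], which
    [L] contains as soon as it contains [c ^+ n]. *)
Lemma primary_power (D : idomainType) (F : set (set D)) (Q L : set D) c :
  localizing F -> prime_ideal Q -> primary_to Q L -> Q c ->
  F (sat Q [set t | exists r, t = r * c]) -> F L.
Proof.
move=> [FT Fsub Fgab] pQ [idL _ LM radL] Qc FA.
pose A n : set D := [set t | exists r, t = r * c ^+ n].
have idA n : ideal (A n).
  split; first by exists 0; rewrite mul0r.
    by move=> _ _ [r ->] [r' ->]; exists (r + r'); rewrite mulrDl.
  by move=> a _ [r ->]; exists (a * r); rewrite mulrA.
have idS n := ideal_sat pQ (idA n).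
have [n Lcn] : Defs.rad L c by rewrite radL.
have FS : F (sat Q (A n)).
  elim: n {Lcn} => [|n IH].
    apply: (Fsub setT) => // x _; apply: sub_sat => //.
    by exists x; rewrite mulr1.
  apply: (Fgab _ (sat Q (A n))) => // a [s Qs [r sa]].
  apply: (Fsub (sat Q (A 1%N))); [exact: idS | exact: ideal_quo | exact: FA |].
  move=> b [t Qt [r' tb]]; exists (s * t); first exact: prime_mul.
  exists (r * r').
  have -> : s * t * (b * a) = (s * a) * (t * b) by ring.
  rewrite sa tb expr1 exprS.
  by move: (c ^+ n) => e; ring.
apply: Fsub FS _ => // x [s Qs [r sx]].
have : L (x * s) by rewrite mulrC sx; case: idL => _ _; apply.
by move=> /LM[//|]; rewrite radL.
Qed.

Lemma ideal_rad (D : idomainType) (I : set D) : ideal I -> ideal (Defs.rad I).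
Proof.
case=> I0 ID IM; split.
- by exists 1%N; rewrite expr1.
- move=> x y [n Ix] [m Iy]; exists (n + m)%N; rewrite exprDn.
  apply: big_ind => // i _; rewrite -mulr_natl; apply: (IM).
  have [mi|im] := leqP m i.
    by rewrite -(subnK mi) exprD mulrA; apply: IM.
  by rewrite -addnBA 1?ltnW // addnC exprD mulrC mulrA; apply: IM.
- by move=> a x [n Ix]; exists n; rewrite exprMn; apply: IM.
Qed.

(** Supplies the closed primary ideal that [PsSpec] asks for. Membership of x in L^* meet D depends
    only on (L : x), and (L : xy) = (L : x) for y outside [Q]; so the closure stays primary. *)
Lemma primary_closure (D : idomainType)
    (star : set {fraction D} -> set {fraction D}) (Q L : set D) :
  semistar star -> stable star -> prime_ideal Q -> primary_to Q L ->
  ~ star (inK L) 1 ->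
  exists2 L', primary_to Q L' & L' = capD (star (inK L')).
Proof.
move=> ss stab pQ [idL L1 LM radL] nFL.
have [subS [ext mono idem _]] := ss.
have sL := submodule_inK idL; have [S0 SD SM] := subS _ sL.
pose L' := capD (star (inK L)).
have idL' : ideal L'.
  by split=> [|x y|a x]; rewrite /L' /capD /= ?tofrac0 ?tofracD ?tofracM;
    [|exact: SD|exact: SM].
have sL' := submodule_inK idL'.
have LL' : L `<=` L' by move=> x Lx; apply: ext => //; exists x.
have L'E x : L' x <-> star (inK (quo L x)) 1.
  by rewrite -conductor_inK; exact: stable_memE.
have quoE x y : ~ Q y -> quo L (x * y) = quo L x.
  move=> Qy; apply/seteqP; split=> t; rewrite /quo /= mulrA.
    by move=> /LM[//|]; rewrite radL.
  by move=> Ltx; rewrite mulrC; case: idL => _ _; apply.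
have radL' : Defs.rad L' = Q.
  apply/seteqP; split=> x.
    move=> [n /L'E Fx]; apply: contrapT => Qx; apply: nFL.
    by move: Fx; rewrite -[x ^+ n]mul1r quoE ?quo1 // => /(prime_exp pQ).
  by rewrite -radL => -[n /LL' Lx]; exists n.
exists L'; first split=> //.
- move=> x y /L'E Fxy; rewrite radL'; have [Qy|Qy] := pselect (Q y); first by right.
  by left; apply/L'E; rewrite -(quoE x y).
- apply/seteqP; split=> x; first by move=> L'x; apply: ext => //; exists x.
  rewrite /capD /= => Sx; rewrite /L' /capD /= -idem //.
  by apply: (mono _ _ sL' (subS _ sL)) Sx => _ [y L'y <-].
Qed.

(** * Spectrality and the normalized stable version *)

Lemma radical_spectral (D : idomainType)
    (star : set {fraction D} -> set {fraction D}) :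
  countable (Spec D) -> semistar star -> radical star -> spectral star.
Proof.
move=> cS ss [qr stab]; have loc := stable_localizing ss stab.
have [FT Fsub _] := loc.
exists [set P | prime_ideal P /\ ~ star (inK P) 1]; first by move=> P [].
move=> I subI; apply/seteqP; split=> x.
  (* An ideal of the system lies in no prime outside it, so (I : x) has an element outside [P]. *)
  move=> /(stable_memE x ss stab subI) Fx P [pP nFP].
  apply/mul_localizationE => //; apply: contrapT => no; apply: nFP.
  apply: (Fsub _ _ (ideal_conductor x subI)) Fx _; first by case: pP.
  by move=> s Is; apply: contrapT => Ps; apply: no; exists s.
move=> xP; apply/(stable_memE x ss stab subI); apply: contrapT => nF.
have idJ := ideal_conductor x subI; set J := conductor I x in nF idJ.
have idR : ideal (Defs.rad J) by exact: ideal_rad.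
have radR : Defs.rad (Defs.rad J) = Defs.rad J.
  apply/seteqP; split=> [y [n [m Jy]]|y Jy]; last by exists 1%N; rewrite expr1.
  by exists (n * m)%N; rewrite exprM.
(* Quasi-radicality keeps the radical of [J] outside the system, so that some prime above it is
   outside too. *)
have [P [pP JP nFP]] := localizing_radical_prime cS loc idR radR (qr J idJ nF).
have /mul_localizationE[//|//|s Ps Isx] := xP P (conj pP nFP).
by apply/Ps/JP; exists 1%N; rewrite expr1.
Qed.

Lemma stable_normalized (D : idomainType)
    (star : set {fraction D} -> set {fraction D}) (I : set {fraction D}) :
  countable (Spec D) -> Prufer D -> semistar star -> stable star ->
  submodule I -> star I = normalized_stable star I.
Proof.
move=> cS prD ss stab subI; have loc := stable_localizing ss stab.
have [FT Fsub _] := loc; have [subI0 subID subIM] := subI.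
have val (Q : set D) : prime_ideal Q -> valuation_at Q.
  exact: Prufer_valuation.
(* For a outside [P], (P : a) lies in [P]; so P^* meet D exceeds [P] only when [P] is in the
   system. *)
have QSpecE (P : set D) : prime_ideal P -> QSpec star P <-> ~ star (inK P) 1.
  move=> pP; have idP : ideal P by case: pP.
  have [_ [ext _ _ _]] := ss; split=> [[_ PE] FP|nFP].
    by have [_ P1 _] := pP; apply: P1; rewrite PE /capD /= tofrac1.
  split=> //; apply/seteqP; split=> a Pa.
    by apply: ext; [exact: submodule_inK | exists a].
  move: Pa => /(stable_memE _ ss stab (submodule_inK idP)).
  rewrite conductor_inK => Fa; apply: contrapT => nPa; apply: nFP.
  apply: Fsub Fa _ => //; first exact: ideal_quo.
  by case: (pP) => _ _ PM t /PM[].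
apply/seteqP; split=> x.
  move=> /(stable_memE x ss stab subI) Fx; have idJ := ideal_conductor x subI.
  split=> [P QP|Q [pQ FQ [L prL closL]] y yI].
    have pP : prime_ideal P by case: QP.
    apply/mul_localizationE => //; apply: contrapT => no.
    apply: (proj1 (QSpecE P pP) QP); apply: Fsub Fx _ => //; first by case: pP.
    by move=> s Is; apply: contrapT => Ps; apply: no; exists s.
  case: yI => w wI <-; apply: contrapT => nloc.
  (* The inverse [c/s] of [x * w] is in Q D_Q. For t in (I : x), t x w is in [D_Q], so t is in c
     D_Q. Hence the contraction of c D_Q is in the system, and so is [L], against its being closed
     and proper. *)
  have [s [c [Qs Qc xwc]]] := notin_localization pQ (val Q pQ) nloc.
  have [idL L1 _ _] := prL.
  apply: L1; rewrite closL /capD /= tofrac1.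
  apply: (primary_power loc pQ prL Qc); apply: Fsub Fx _ => //.
    apply: ideal_sat => //; split; first by exists 0; rewrite mul0r.
      by move=> _ _ [r ->] [r' ->]; exists (r + r'); rewrite mulrDl.
    by move=> a _ [r ->]; exists (a * r); rewrite mulrA.
  move=> t Itx; have [a [s' [Qs' wtx]]] : localization Q (w * (t%:F * x)).
    apply: wI; exists (t%:F * x) => //; apply/mul_localizationE => //.
    by exists 1; [case: pQ | rewrite tofrac1 mul1r].
  exists (s * s'); first exact: prime_mul.
  exists a; apply/eqP; rewrite -tofrac_eq !tofracM -xwc.
  have s'0 : s'%:F != 0.
    rewrite tofrac_eq0; apply/eqP => s'0; apply: Qs'; rewrite s'0.
    by case: (pQ) => -[].
  have -> : x * w * c%:F * s'%:F * t%:F = w * (t%:F * x) * s'%:F * c%:F by ring.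
  by rewrite wtx divfK.
move=> [xP xQ]; apply/(stable_memE x ss stab subI).
have idJ := ideal_conductor x subI.
apply: (localizing_valuation cS loc val idJ) => Q pQ JQ.
(* Otherwise x is in I D_Q, and a denominator outside [Q] lies in (I : x), hence in [Q]. *)
have FQ : star (inK Q) 1.
  apply: contrapT => nFQ.
  have /mul_localizationE[//|//|s Qs Isx] := xP Q (proj2 (QSpecE Q pQ) nFQ).
  by apply/Qs/JQ.
split=> //; apply: contrapT => /not_orP[].
move=> /existsNP[L /not_implyP[prL nFL]] /existsNP[q /not_implyP[Qq nq]].
have [idQ Q1 QM] := pQ; have [_ _ QZ] := idQ.
have q0 : q%:F != 0.
  rewrite tofrac_eq0; apply/eqP => q0; apply: nq; rewrite q0.
  by case: (ideal_sat pQ idJ).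
have x0 : x != 0.
  apply/eqP => x0; apply/Q1/JQ; rewrite /conductor /= x0 mulr0.
  exact: subI0.
have : PsSpec star Q.
  by split; [| | exact: primary_closure prL nFL].
(* 1/(xq) maps I D_Q into [D_Q]: if m/(xq) were outside, xq would be a multiple of m in [D_Q],
   putting q in J D_Q. Hence 1/q = x/(xq) is in [D_Q], which is absurd for q in [Q]. *)
move=> /xQ xv; have [a [s [Qs qE]]] : localization Q (x * (x * q%:F)^-1).
  apply: xv; exists (x * q%:F)^-1 => // _ [m mI <-].
  have /mul_localizationE[//|//|s Qs Ism] := mI.
  apply: contrapT => nloc.
  have [s' [c [Qs' _ mE]]] := notin_localization pQ (val Q pQ) nloc.
  apply: nq; exists (s * s'); first exact: prime_mul.
  have mc : m * c%:F = s'%:F * (x * q%:F).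
    by rewrite -mE [in RHS]mulrC -mulrA mulVKf ?mulf_neq0.
  rewrite /conductor /=.
  have -> : (s * s' * q)%:F * x = c%:F * (s%:F * m).
    rewrite (mulrCA c%:F) (mulrC c%:F) mc !tofracM; ring.
  exact: subIM.
have s0 : s%:F != 0.
  rewrite tofrac_eq0; apply/eqP => s0; apply: Qs; rewrite s0.
  by case: idQ.
apply: Qs; have -> : s = a * q; last exact: QZ.
apply/eqP; rewrite -tofrac_eq tofracM.
move/eqP: qE; rewrite invfM mulVKf // -[q%:F^-1]mul1r eqr_div //.
by rewrite mul1r.
Qed.

Theorem corollary6p8 (D : idomainType) (hSpec : countable (Spec D)) :
  (forall star : set {fraction D} -> set {fraction D},
      semistar star -> radical star -> spectral star) /\
  (Prufer D ->
   forall star : set {fraction D} -> set {fraction D},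
      semistar star -> stable star ->
      forall I : set {fraction D}, submodule I ->
        star I = normalized_stable star I).
Proof.
split=> [star ss rs|prD star ss stab I subI].
  exact: radical_spectral.
exact: stable_normalized.
Qed.
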